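(* Each of the four cellular automata $\mathsf{R}$, $\mathsf{F}$, $\mathsf{M}$, $\mathsf{T}$ defined below is a robust memory under synchronous updates. That is, for each $\mathcal{A}\in\{\mathsf{R},\mathsf{F},\mathsf{M},\mathsf{T}\}$ there is an open ball $U$ in the $(p,\eta)$ parameter plane, whose radius does not depend on $L$, such that for every $(p,\eta)\in U$ the memory time of the noisy synchronous dynamics of $\mathcal{A}$ on the $L\times L$ torus satisfies $\lim_{L\to\infty} t_{\rm mem}=\infty$.
   Context: Spins $s_{\mathbf r}\in\{+1,-1\}$ live on the sites $\mathbf r\in(\mathbb Z/L\mathbb Z)^2$ of an $L\times L$ square lattice with periodic boundary conditions; $\hat{\mathbf x}=(1,0)$, $\hat{\mathbf y}=(0,1)$. A spin $+1$ is treated as Boolean true and $-1$ as false, so $a\wedge b=\min(a,b)$ and $a\vee b=\max(a,b)$. Time $t$ is discrete. The noiseless rules (all spins updated simultaneously at each time step, using the configuration at time $t$) are: $\mathsf{R}$: $s_{\mathbf r}(t+1)=s_{\mathbf r+\hat{\mathbf y}}\wedge s_{\mathbf r}\wedge s_{\mathbf r-\hat{\mathbf y}}$ for $t$ even, and $s_{\mathbf r+\hat{\mathbf x}}\vee s_{\mathbf r}\vee s_{\mathbf r-\hat{\mathbf x}}$ for $t$ odd. $\mathsf{F}$: $s_{\mathbf r}(t+1)=s_{\mathbf r+\hat{\mathbf x}}\vee s_{\mathbf r-\hat{\mathbf x}-\hat{\mathbf y}}$ for $t$ even, and $s_{\mathbf r+\hat{\mathbf x}+\hat{\mathbf y}}\wedge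 s_{\mathbf r-\hat{\mathbf y}}$ for $t$ odd. $\mathsf{M}$: $s_{\mathbf r}(t+1)=s_{\mathbf r+\hat{\mathbf x}}\vee s_{\mathbf r+\hat{\mathbf y}}$ for $t$ even, and $s_{\mathbf r+\hat{\mathbf x}}\wedge s_{\mathbf r-\hat{\mathbf y}}$ for $t$ odd. $\mathsf{T}$: $s_{\mathbf r}(t+1)=s_{\mathbf r}\vee s_{\mathbf r+\hat{\mathbf x}}\vee s_{\mathbf r-\hat{\mathbf y}}$ for $t$ even, and $s_{\mathbf r}\wedge s_{\mathbf r+\hat{\mathbf x}}\wedge s_{\mathbf r-\hat{\mathbf y}}$ for $t$ odd. Noisy synchronous dynamics with noise strength $p\in[0,1]$ and bias $\eta\in[-1,1]$: at each time step, independently for each site, $s_{\mathbf r}(t+1)$ is set to the value given by the noiseless rule with probability $1-p$, and otherwise is set to $+1$ with probability $p(1+\eta)/2$ and to $-1$ with probability $p(1-\eta)/2$. Let $s_\pm$ denote the all-$(\pm1)$ configurations and $m(s)=L^{-2}\sum_{\mathbf r}s_{\mathbf r}$ the magnetization. The memory time is $t_{\rm mem}=\mathbb E\,\min_{\pm}\{t : \pm m[\mathcal A^t(s_\pm)]<1/2\}$, i.e. the expected (over noise realizations) first time at which the magnetization, starting from a logical state $s_\pm$, has relaxed below half its initial value in absolute value (minimized over the two choices of initial logical state). $\mathcal A$ is a robust memory if there is an open ball in the $(p,\eta)$ plane, with radius remaining finite as $L\to\infty$, on which $\lim_{L\to\infty}t_{\rm mem}=\infty$. *)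

(* Defs.v *)
From HB Require Import structures.
From mathcomp Require Import all_boot all_order all_algebra.
From mathcomp Require Import all_classical all_reals all_analysis.
Set Implicit Arguments. Unset Strict Implicit. Unset Printing Implicit Defensive.
Import Order.TTheory GRing.Theory Num.Theory.
Local Open Scope classical_set_scope.
Local Open Scope ring_scope.

(* Sites of the L x L torus (Z/LZ)^2; first component = x, second = y. *)
Definition site (L : nat) := ('I_L * 'I_L)%type.

Lemma ord_gt0 (L : nat) (i : 'I_L) : (0 < L)%N.
Proof. exact: (leq_ltn_trans (leq0n i) (ltn_ord i)). Qed.

Definition shI (L : nat) (i : 'I_L) (d : nat) : 'I_L :=
  Ordinal (ltn_pmod (i + d)%N (ord_gt0 i)).

Definition xp L (r : site L) : site L := (shI r.1 1, r.2).
Definition xm L (r : site L) : site L := (shI r.1 L.-1, r.2).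
Definition yp L (r : site L) : site L := (r.1, shI r.2 1).
Definition ym L (r : site L) : site L := (r.1, shI r.2 L.-1).

(* spin +1 = true, -1 = false; /\ = &&, \/ = || *)
Definition config L := site L -> bool.

Inductive CA := CA_R | CA_F | CA_M | CA_T.

(* noiseless rule applied at time t (to get the configuration at t+1) *)
Definition rule (A : CA) (L : nat) (t : nat) (s : config L) : config L :=
  fun r =>
  match A with
  | CA_R => if ~~ odd t then [&& s (yp r), s r & s (ym r)]
            else [|| s (xp r), s r | s (xm r)]
  | CA_F => if ~~ odd t then s (xp r) || s (xm (ym r))
            else s (xp (yp r)) && s (ym r)
  | CA_M => if ~~ odd t then s (xp r) || s (yp r)
            else s (xp r) && s (ym r)
  | CA_T => if ~~ odd t then [|| s r, s (xp r) | s (ym r)]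
            else [&& s r, s (xp r) & s (ym r)]
  end.

(* Noise at one site for one time step: None = apply the noiseless rule,
   Some true = set to +1, Some false = set to -1. *)
Definition noise_field L := {ffun site L -> option bool}.

Definition noise_weight (R : realType) (p eta : R) (a : option bool) : R :=
  match a with
  | None => 1 - p
  | Some true => p * (1 + eta) / 2
  | Some false => p * (1 - eta) / 2
  end.

Definition step (A : CA) L (t : nat) (w : noise_field L) (s : config L) : config L :=
  fun r => match w r with None => rule A t s r | Some b => b end.

Fixpoint traj (A : CA) L (omega : nat -> noise_field L) (s0 : config L) (n : nat)
  : config L :=
  match n with
  | 0 => s0
  | n'.+1 => step A n' (omega n') (traj A omega s0 n')
  end.

Definition splus L : config L := fun _ => true.
Definition sminus L : config L := fun _ => false.

Definition magn (R : realType) L (s : config L) : R :=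
  (\sum_(r : site L) (if s r then 1 else -1 : R)) / (L%:R ^+ 2).

Definition ext_noise L (t : nat) (w : {ffun 'I_t -> noise_field L})
  : nat -> noise_field L :=
  fun n => oapp (fun i : 'I_t => w i) [ffun _ => None] (insub n).

(* The event {T > t}, T = min over +/- of the first time the magnetization of
   the run started from s_(+/-) satisfies +/- m < 1/2 (both runs driven by the
   same noise). *)
Definition survives (R : realType) (A : CA) L (t : nat)
  (w : {ffun 'I_t -> noise_field L}) : bool :=
  [forall n : 'I_t.+1,
     (1 / 2 <= magn R (traj A (ext_noise w) (@splus L) n)) &&
     (1 / 2 <= - magn R (traj A (ext_noise w) (@sminus L) n))].

(* P(T > t): noise fields at different times/sites are independent *)
Definition surv_prob (R : realType) (A : CA) L (p eta : R) (t : nat) : R :=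
  \sum_(w : {ffun 'I_t -> noise_field L})
     (if survives R A w then
        \prod_(i < t) \prod_(r : site L) noise_weight p eta (w i r)
      else 0).

(* t_mem = E[T] = sum_{t >= 0} P(T > t)  (tail-sum formula), in \bar R *)
Definition t_mem (R : realType) (A : CA) L (p eta : R) : \bar R :=
  (\sum_(0 <= t <oo) (surv_prob A L p eta t)%:E)%E.

Definition robust_memory (R : realType) (A : CA) : Prop :=
  exists (p0 eta0 rad : R), 0 < rad /\
    forall p eta : R, (p - p0) ^+ 2 + (eta - eta0) ^+ 2 < rad ^+ 2 ->
      [/\ 0 <= p <= 1, -1 <= eta <= 1 &
          (t_mem A L p eta @[L --> \oo] --> +oo)%E].

(* Main.v *)
Require Import Defs.
From mathcomp Require Import all_boot all_order all_algebra.
From mathcomp Require Import all_classical all_reals all_analysis.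
From mathcomp Require Import zify ring lra.
Set Implicit Arguments. Unset Strict Implicit. Unset Printing Implicit Defensive.
Import Order.TTheory GRing.Theory Num.Theory.
Local Open Scope classical_set_scope.
Local Open Scope ring_scope.

(** For a fixed time [t], sites far apart evolve independently up to time [t],
so by Chebyshev's inequality the magnetization concentrates as [L] grows; the
memory time therefore diverges as soon as the probability that a site carries
the minority spin is at most 1/16 uniformly in time.

That uniform bound is a Peierls argument in the spirit of Toom.  Every rule
alternates a step that spreads the minority with a step that erodes it.  There
are three space-time functionals of sum zero such that a noiseless minority
point has, one double step earlier, three minority points (or noisy
intermediate points) excusing it, the j-th one being higher for the j-th
functional.  Adding the points one at a time in chronological order, one keeps
track of the connected components of the excuse graph and shows that any three
points [x], [y], [z] of a component lie on a closed walk of the component whose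
length is at most linear in its number of noisy points, minus a multiple of
[L1 x + L2 y + L3 z]: an increase of the functionals pays for the new point, and
merging components pays because their noisy points are distinct.  Hence a
minority point starts a walk with a positive density of distinct noisy points,
and walks are counted by a union bound. *)

(** * Excuse graphs, their components and closed walks *)

Section Explanation.
Variables (P : eqType) (adj : rel P) (err : pred P) (L1 L2 L3 : P -> int).
Hypothesis adjxx : reflexive adj.
Hypothesis adjC : symmetric adj.
Hypothesis L0 : forall x, L1 x + L2 x + L3 x = 0.

(** The edge between [s] and [a] is crossed once in each direction, so each of its ends is listed
    once more. *)
Lemma cycle_attach (c0 c : seq P) (s a : P) :
  cycle adj c0 -> s \in c0 -> cycle adj c -> a \in c -> adj s a ->
  exists c1, [/\ cycle adj c1, c1 =i c0 ++ c & size c1 = (size c0 + size c).+2].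
Proof.
move=> cyc0 /rot_to[i0 d0 e0] cyc /rot_to[i d e] adjsa.
have m0 q : (q \in c0) = (q \in s :: d0) by rewrite -e0 mem_rot.
have m q : (q \in c) = (q \in a :: d) by rewrite -e mem_rot.
have z0 : size c0 = size (s :: d0) by rewrite -e0 size_rot.
have z : size c = size (a :: d) by rewrite -e size_rot.
have {}cyc0 : cycle adj (s :: d0) by rewrite -e0 rot_cycle.
have {}cyc : cycle adj (a :: d) by rewrite -e rot_cycle.
move: cyc0 cyc => /= cyc0 cyc.
exists (s :: a :: rcons d a ++ s :: d0); split.
- rewrite /= adjsa /= rcons_cat cat_path cyc last_rcons /=.
  by rewrite adjC adjsa.
- move=> q; rewrite mem_cat m0 m !inE mem_cat mem_rcons !inE.
  by case: (q == s); case: (q == a); case: (q \in d); case: (q \in d0).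
- by rewrite z0 z /= size_cat size_rcons /=; lia.
Qed.

(** By reflexivity of [adj], [s] alone is a closed walk of size 1; two attachments add 2 each,
    whence 5. *)
Lemma cycle_join (s b b' : P) (c c' : seq P) :
  cycle adj c -> b \in c -> adj s b -> cycle adj c' -> b' \in c' -> adj s b' ->
  exists d, [/\ cycle adj d, d =i s :: c ++ c' & size d = (size c + size c' + 5)%N].
Proof.
move=> cc bc sb cc' bc' sb'; have s0 : cycle adj [:: s] by rewrite /= adjxx.
have [d1 [cd1 ed1 zd1]] := cycle_attach s0 (mem_head s [::]) cc bc sb.
have sd1 : s \in d1 by rewrite ed1 mem_head.
have [d [cd ed zd]] := cycle_attach cd1 sd1 cc' bc' sb'.
exists d; split=> //; last by rewrite zd zd1 /=; lia.
by move=> q; rewrite ed mem_cat ed1 !inE mem_cat orbA.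
Qed.

Definition excuse (s a : P) : Prop :=
  [/\ adj s a, -20 <= L1 a - L1 s <= 20, -20 <= L2 a - L2 s <= 20
    & -20 <= L3 a - L3 s <= 20].

(* [H] lists points in reverse chronological order, each one noisy or excused by
   later entries. *)
Fixpoint explained (H : seq P) : Prop :=
  if H is s :: H' then
    explained H' /\
    (err s \/ exists a1 a2 a3,
      [/\ a1 \in H', a2 \in H' & a3 \in H'] /\
      [/\ excuse s a1, excuse s a2 & excuse s a3] /\
      [/\ L1 s + 1 <= L1 a1, L2 s + 1 <= L2 a2 & L3 s + 1 <= L3 a3])
  else True.

Lemma explained_cat (H1 H2 : seq P) :
  explained H1 -> explained H2 -> explained (H1 ++ H2).
Proof.
move=> + e2; elim: H1 => [|s H IH] //= [/IH e [es|]]; first by split; [|left].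
move=> [a1 [a2 [a3 [[m1 m2 m3] x]]]]; split=> //; right.
by exists a1, a2, a3; rewrite !mem_cat m1 m2 m3.
Qed.

(* The constants: 20 bounds the variation of the functionals along an excuse, 3 is
   the length of attaching one point to a closed walk, and 126 = 6 + 6 * 20 makes
   the gain of one noisy point pay for a merger of two components. *)
Definition certificate (H : pred P) (x y z : P) (c l : seq P) : Prop :=
  [/\ cycle adj c, [/\ x \in c, y \in c & z \in c], {subset c <= H},
      [/\ uniq l, {subset l <= c} & all err l]
    & (size c)%:Z <= 126 * ((size l)%:Z - 1) + 1 - 3 * (L1 x + L2 y + L3 z)].

(* [f] labels the connected components. *)
Definition certified (H : seq P) (f : P -> nat) : Prop :=
  forall x y z, x \in H -> y \in H -> z \in H -> f x = f y -> f x = f z ->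
    exists c l, certificate [pred q | (q \in H) && (f q == f x)] x y z c l.

(** A point carries a single label. Hence the numbers of noisy points add up in a merger. *)
Lemma certificates_disjoint (H : seq P) (f : P -> nat) (i j : nat) (c c' l l' : seq P) :
  i != j -> {subset c <= [pred q | (q \in H) && (f q == i)]} ->
  {subset c' <= [pred q | (q \in H) && (f q == j)]} ->
  {subset l <= c} -> {subset l' <= c'} -> uniq l -> uniq l' -> uniq (l ++ l').
Proof.
move=> ij sc sc' sl sl' ul ul'; rewrite cat_uniq ul ul' andbT /=.
apply/hasPn => q /sl' /sc' /andP[_ /eqP fq]; apply/negP => /sl /sc /andP[_].
by rewrite fq eq_sym (negbTE ij).
Qed.


(** [s] opens a component of its own; shifting the old labels frees the label 0 for it. *)
Lemma certified_error (H : seq P) (f : P -> nat) (s : P) :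
  s \notin H -> certified H f -> err s ->
  certified (s :: H) (fun x => if x == s then 0%N else (f x).+1).
Proof.
move=> sH cH es x y z; rewrite !inE.
case: (x =P s) => [->|/eqP xs]; case: (y =P s) => [->|/eqP ys] //;
  case: (z =P s) => [->|/eqP zs] //=.
- move=> _ _ _ _ _; exists [:: s], [:: s]; split=> //=.
  + by rewrite adjxx.
  + by rewrite inE eqxx.
  + by move=> q; rewrite !inE /= => ->.
  + by split; rewrite ?es.
  + by have := L0 s; lia.
- move=> xH yH zH [fxy] [fxz]; have [c [l [cc m sc lc b]]] := cH x y z xH yH zH fxy fxz.
  exists c, l; split=> // q /sc; rewrite !inE => /andP[qH qf].
  rewrite qH orbT ifN; first by [].
  by apply: contraNneq sH => <-.
Qed.

(** [s] fuses with the components of its excuses under the label 0. The new closed walk is glued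
    from old certificates; the cases are the number of old components met. *)
Lemma certified_excused (H : seq P) (f : P -> nat) (s a1 a2 a3 : P) :
  s \notin H -> certified H f ->
  [/\ a1 \in H, a2 \in H & a3 \in H] ->
  [/\ excuse s a1, excuse s a2 & excuse s a3] ->
  [/\ L1 s + 1 <= L1 a1, L2 s + 1 <= L2 a2 & L3 s + 1 <= L3 a3] ->
  certified (s :: H)
    (fun x => if (x == s) || (f x \in [:: f a1; f a2; f a3]) then 0%N else (f x).+1).
Proof.
move=> sH cH [a1H a2H a3H] [x1 x2 x3] [g1 g2 g3].
set A := [:: f a1; f a2; f a3]; set f' := fun x => _.
have f'H q : q \in H -> f' q = if f q \in A then 0%N else (f q).+1.
  move=> qH; rewrite /f'; case: eqP => //= qs.
  by move: sH; rewrite -qs qH.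
have subH (i j : nat) (c : seq P) : (forall q, q \in H -> f q = i -> f' q = j) ->
    {subset c <= [pred q | (q \in H) && (f q == i)]} ->
    {subset c <= [pred q | (q \in s :: H) && (f' q == j)]}.
  move=> ij sc q /sc /andP[qH /eqP fq].
  by rewrite !inE qH orbT /= (ij q qH fq).
move=> x y z xH yH zH fxy fxz.
case E: (f' x) => [|k]; last first.
  have nin q : q \in s :: H -> f' q = k.+1 -> [/\ q \in H, f q = k & f q \notin A].
    rewrite inE /f'; case: eqP => //= _ qH; case: ifP => //= fA [fq].
    by split=> //; apply: negbT.
  have [xH' fx xA] := nin x xH E.
  have [yH' fy yA] := nin y yH (etrans (esym fxy) E).
  have [zH' fz zA] := nin z zH (etrans (esym fxz) E).
  have [c [l [cc m sc lc b]]] := cH x y z xH' yH' zH' (etrans fx (esym fy)) (etrans fx (esym fz)).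
  exists c, l; split=> //; apply: subH sc => q qH fq.
  by rewrite f'H // fq (negbTE xA) fx.
have att b : b \in [:: a1; a2; a3] -> [/\ b \in H, excuse s b & f b \in A].
  by rewrite !inE => /or3P[] /eqP ->; rewrite eqxx ?orbT.
(* A required point equal to [s] is replaced by the excuse that gains in [Lj]; an old point stands
   for itself. Through [b], the component of [m] can be attached to [s]. *)
have leg (Lj : P -> int) a w : a \in [:: a1; a2; a3] -> Lj s + 1 <= Lj a ->
    w \in s :: H -> f' w = 0%N -> exists m b,
    [/\ m \in H, b \in [:: a1; a2; a3], f b = f m, Lj w <= Lj m
      & w = m \/ w = s /\ (Lj w + 1 <= Lj m /\ adj s m)].
  move=> aA ga; rewrite inE /f'; case: eqP => [-> _ _|_] /=.
    have [aH [adja _ _ _] _] := att _ aA.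
    by exists a, a; split=> //; [clear -ga; lia|right].
  move=> wH; case: ifP => // fA _; move: fA; rewrite !inE => /or3P[] /eqP fA.
  - by exists w, a1; split; rewrite ?inE ?eqxx //; left.
  - by exists w, a2; split; rewrite ?inE ?eqxx ?orbT //; left.
  - by exists w, a3; split; rewrite ?inE ?eqxx ?orbT //; left.
have [|m1 [b1 [m1H b1A fb1 L1m m1x]]] := leg L1 a1 x _ g1 xH E; first by rewrite !inE eqxx.
have [|m2 [b2 [m2H b2A fb2 L2m m2y]]] := leg L2 a2 y _ g2 yH (etrans (esym fxy) E).
  by rewrite !inE eqxx orbT.
have [|m3 [b3 [m3H b3A fb3 L3m m3z]]] := leg L3 a3 z _ g3 zH (etrans (esym fxz) E).
  by rewrite !inE eqxx !orbT.
have [b1H [sb1 u11 u12 u13] fA1] := att _ b1A.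
have [b2H [sb2 u21 u22 u23] fA2] := att _ b2A.
have [b3H [sb3 u31 u32 u33] fA3] := att _ b3A.
have sub m b (c : seq P) : m \in H -> f b = f m -> f b \in A ->
    {subset c <= [pred q | (q \in H) && (f q == f m)]} ->
    {subset c <= [pred q | (q \in s :: H) && (f' q == 0%N)]}.
  by move=> mH fbm fA; apply: subH => q qH fq; rewrite f'H // fq -fbm fA.
have s0 : cycle adj [:: s] by rewrite /= adjxx.
have ss : {subset [:: s] <= [pred q | (q \in s :: H) && (f' q == 0%N)]}.
  by move=> q; rewrite !inE => /eqP ->; rewrite /f' !eqxx.
have incl (d c c' : seq P) (q : pred P) : d =i c ++ c' ->
    {subset c <= q} -> {subset c' <= q} -> {subset d <= q}.
  by move=> e i1 i2 t; rewrite e mem_cat => /orP[/i1|/i2].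
have incl3 (d c c' : seq P) : d =i s :: c ++ c' ->
    {subset c <= [pred q | (q \in s :: H) && (f' q == 0%N)]} ->
    {subset c' <= [pred q | (q \in s :: H) && (f' q == 0%N)]} ->
    {subset d <= [pred q | (q \in s :: H) && (f' q == 0%N)]}.
  move=> e i1 i2 q; rewrite e inE mem_cat => /or3P[/eqP ->|/i1|/i2] //.
  by apply: ss; rewrite mem_head.
have join_sub (d c c' : seq P) : d =i s :: c ++ c' ->
    [/\ s \in d, {subset c <= d} & {subset c' <= d}].
  move=> e; split; first by rewrite e mem_head.
    by move=> q qc; rewrite e inE mem_cat qc orbT.
  by move=> q qc; rewrite e inE mem_cat qc !orbT.
have z1 := L0 b1; have z2 := L0 b2; have z3 := L0 b3; have zs := L0 s.
have legin (d : seq P) w m (Q : Prop) : s \in d -> m \in d -> w = m \/ w = s /\ Q -> w \in d.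
  by move=> sd md [->|[-> _]].
case: (f m1 =P f m2) => [f12|f12].
  case: (f m1 =P f m3) => [f13|f13].
    have [c [l [cc [i1 i2 i3] sc [ul lc le] bd]]] := cH m1 m2 m3 m1H m2H m3H f12 f13.
    (* If [s] is a required point, attaching it costs 3, which the gain of at least 1, weighted by
       3, pays. *)
    case: (boolP [|| x == s, y == s | z == s]) => [gain|]; last first.
      rewrite !negb_or => /and3P[/eqP xs /eqP ys /eqP zs'].
      case: m1x => [e1|[]] //; case: m2y => [e2|[]] //; case: m3z => [e3|[]] //.
      rewrite e1 e2 e3; exists c, l; split=> //.
      by apply: (sub m1 b1).
    have [b [bc sb gn]] : exists b, [/\ b \in c, adj s b
        & L1 x + L2 y + L3 z + 1 <= L1 m1 + L2 m2 + L3 m3].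
      have mem_s w m (Q : Prop) : m \in H -> w = s -> w = m \/ w = s /\ (Q /\ adj s m) ->
          Q /\ adj s m.
        by move=> mH -> [e|[_ ]] //; rewrite e mH in sH.
      case/or3P: gain => /eqP e.
      + have [g a] := mem_s _ _ _ m1H e m1x; exists m1; split=> //; clear -g L1m L2m L3m; lia.
      + have [g a] := mem_s _ _ _ m2H e m2y; exists m2; split=> //; clear -g L1m L2m L3m; lia.
      + have [g a] := mem_s _ _ _ m3H e m3z; exists m3; split=> //; clear -g L1m L2m L3m; lia.
    have [d [cd ed zd]] := cycle_attach s0 (mem_head s [::]) cc bc sb.
    have dm w : w \in c -> w \in d by rewrite ed mem_cat orbC => ->.
    have sd : s \in d by rewrite ed mem_head.
    exists d, l; split=> //.
    + by split; [apply: legin m1x|apply: legin m2y|apply: legin m3z] => //; apply: dm.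
    + by apply: incl ed ss _; apply: (sub m1 b1).
    + by split=> // w /lc /dm.
    + by rewrite zd /=; clear -gn bd; lia.
  (* Two components: the functionals are off by [L3 b1 - L3 b3], at most 40 in absolute value. With
     5 for the join and 1 for the second additive constant, the cost 6 + 3 * 40 is exactly one noisy
     point. *)
  have [c [l [cc [i1 i2 i3] sc [ul lc le] bd]]] :=
    cH m1 m2 b1 m1H m2H b1H f12 (esym fb1).
  have [c' [l' [cc' [j1 j2 j3] sc' [ul' lc' le'] bd']]] :=
    cH b3 b3 m3 b3H b3H m3H erefl fb3.
  have [d [cd md zd]] := cycle_join cc i3 sb1 cc' j1 sb3; have [sd dc dc'] := join_sub _ _ _ md.
  exists d, (l ++ l'); split=> //.
  + by split; [apply: legin m1x|apply: legin m2y|apply: legin m3z] => //;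
      [apply: dc|apply: dc|apply: dc'].
  + by apply: (incl3 _ _ _ md); [apply: (sub m1 b1)|apply: (sub b3 b3)].
  + split; last by rewrite all_cat le.
      by apply: certificates_disjoint sc sc' lc lc' ul ul'; rewrite fb3; apply/eqP.
    by move=> q; rewrite mem_cat => /orP[/lc/dc|/lc'/dc'].
  + rewrite zd size_cat.
    by clear -bd bd' L1m L2m L3m z1 z2 z3 u11 u12 u13 u21 u22 u23 u31 u32 u33; lia.
case: (f m1 =P f m3) => [f13|f13].
  have [c [l [cc [i1 i2 i3] sc [ul lc le] bd]]] :=
    cH m1 b1 m3 m1H b1H m3H (esym fb1) f13.
  have [c' [l' [cc' [j1 j2 j3] sc' [ul' lc' le'] bd']]] :=
    cH b2 m2 b2 b2H m2H b2H fb2 erefl.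
  have [d [cd md zd]] := cycle_join cc i2 sb1 cc' j1 sb2; have [sd dc dc'] := join_sub _ _ _ md.
  exists d, (l ++ l'); split=> //.
  + by split; [apply: legin m1x|apply: legin m2y|apply: legin m3z] => //;
      [apply: dc|apply: dc'|apply: dc].
  + by apply: (incl3 _ _ _ md); [apply: (sub m1 b1)|apply: (sub b2 b2)].
  + split; last by rewrite all_cat le.
      by apply: certificates_disjoint sc sc' lc lc' ul ul'; rewrite fb2; apply/eqP.
    by move=> q; rewrite mem_cat => /orP[/lc/dc|/lc'/dc'].
  + rewrite zd size_cat.
    by clear -bd bd' L1m L2m L3m z1 z2 z3 u11 u12 u13 u21 u22 u23 u31 u32 u33; lia.
have [c [l [cc [i1 i2 i3] sc [ul lc le] bd]]] :=
  cH m1 b1 b1 m1H b1H b1H (esym fb1) (esym fb1).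
case: (f m2 =P f m3) => [f23|f23].
  have [c' [l' [cc' [j1 j2 j3] sc' [ul' lc' le'] bd']]] :=
    cH b2 m2 m3 b2H m2H m3H fb2 (etrans fb2 f23).
  have [d [cd md zd]] := cycle_join cc i2 sb1 cc' j1 sb2; have [sd dc dc'] := join_sub _ _ _ md.
  exists d, (l ++ l'); split=> //.
  + by split; [apply: legin m1x|apply: legin m2y|apply: legin m3z] => //;
      [apply: dc|apply: dc'|apply: dc'].
  + by apply: (incl3 _ _ _ md); [apply: (sub m1 b1)|apply: (sub b2 b2)].
  + split; last by rewrite all_cat le.
      by apply: certificates_disjoint sc sc' lc lc' ul ul'; rewrite fb2; apply/eqP.
    by move=> q; rewrite mem_cat => /orP[/lc/dc|/lc'/dc'].
  + rewrite zd size_cat.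
    by clear -bd bd' L1m L2m L3m z1 z2 z3 u11 u12 u13 u21 u22 u23 u31 u32 u33; lia.
(* Three components: the functionals are off by [- L1 b1 - L2 b2 - L3 b3], within 60 of its value 0
   at [s]. The cost 9 + 3 * 60 is below the 2 * 126 available. *)
have [c' [l' [cc' [j1 j2 j3] sc' [ul' lc' le'] bd']]] :=
  cH b2 m2 b2 b2H m2H b2H fb2 erefl.
have [c2 [l2 [cc2 [k1 k2 k3] sc2 [ul2 lc2 le2] bd2]]] :=
  cH b3 b3 m3 b3H b3H m3H erefl fb3.
have [d' [cd' md' zd']] := cycle_join cc i2 sb1 cc' j1 sb2; have [sd' dc dc'] := join_sub _ _ _ md'.
have [d [cd ed zd]] := cycle_attach cd' sd' cc2 k1 sb3.
have dd' q : q \in d' -> q \in d by rewrite ed mem_cat => ->.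
have dc2 q : q \in c2 -> q \in d by rewrite ed mem_cat orbC => ->.
exists d, (l ++ l' ++ l2); split=> //.
+ by split; [apply: legin m1x|apply: legin m2y|apply: legin m3z];
    rewrite ?(dd' _ sd') //; [apply/dd'/dc|apply/dd'/dc'|apply: dc2].
+ apply: incl ed _ _; last by apply: (sub b3 b3).
  by apply: (incl3 _ _ _ md'); [apply: (sub m1 b1)|apply: (sub b2 b2)].
+ split; last by rewrite !all_cat le le'.
    rewrite catA cat_uniq ul2 andbT; apply/andP; split.
      by apply: certificates_disjoint sc sc' lc lc' ul ul'; rewrite fb2; apply/eqP.
    apply/hasPn => q /lc2/sc2/andP[_ /eqP fq]; rewrite mem_cat; apply/negP.
    move=> /orP[/lc/sc|/lc'/sc'] /andP[_ /eqP]; rewrite fq fb3 ?fb2.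
      by move=> /esym.
    by move=> /esym.
  move=> q; rewrite !mem_cat => /or3P[/lc/dc|/lc'/dc'|/lc2/dc2] //; exact: dd'.
+ rewrite zd zd' !size_cat.
  by clear -bd bd' bd2 L1m L2m L3m z1 z2 z3 u11 u12 u13 u21 u22 u23 u31 u32 u33; lia.
Qed.

Lemma explained_certified (H : seq P) : explained H -> exists f, certified H f.
Proof.
elim: H => [_|s H IH /= [/IH[f cH] es]]; first by exists (fun=> 0%N).
have [sH|sH] := boolP (s \in H).
  (* Concatenated explanations may repeat a point; the set of points, hence the labelling, is then
     unchanged. *)
  exists f => x y z.
  have e w : (w \in s :: H) = (w \in H) by rewrite inE; case: eqP => [->|].
  rewrite !e => xH yH zH fxy fxz; have [c [l [cc m sc lc b]]] := cH x y z xH yH zH fxy fxz.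
  by exists c, l; split=> // q /sc; rewrite /= !inE => /andP[-> ->]; rewrite orbT.
case: es => [es|[a1 [a2 [a3 [aH [ex gain]]]]]].
  by eexists; apply: (certified_error sH cH es).
by eexists; apply: (certified_excused sH cH aH ex gain).
Qed.

(** With all three required points equal to [u] the functionals cancel, so only the noisy points
    bound the length. *)
Lemma explained_walk (H : seq P) (u : P) : explained H -> u \in H ->
  exists p l, [/\ path adj u p, {subset u :: p <= H}, subseq l (u :: p), uniq l & all err l]
    /\ (size p < 126 * size l)%N.
Proof.
move=> /explained_certified[f cH] uH.
have [c [l [cc [uc _ _] sc [ul lc le] bd]]] := cH u u u uH uH uH erefl erefl.
have [i p e] := rot_to uc.
have m q : (q \in c) = (q \in u :: p) by rewrite -e mem_rot.
have z : size c = (size p).+1 by rewrite -(size_rot i c) e.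
have : cycle adj (u :: p) by rewrite -e rot_cycle.
rewrite /= rcons_path => /andP[pp _].
(* The noisy points are relisted in the order of the walk, to become a subsequence of it. *)
pose l' := undup [seq q <- u :: p | q \in l].
have ul' : uniq l' by exact: undup_uniq.
have ll' : l' =i l.
  by move=> q; rewrite mem_undup mem_filter -m; case: (boolP (q \in l)) => // /lc ->.
have sl : subseq l' (u :: p).
  by rewrite /l'; apply: (subseq_trans (undup_subseq _) (filter_subseq _ _)).
have zl : size l' = size l by apply/eqP; rewrite -uniq_size_uniq.
exists p, l'; split; last by have := L0 u; rewrite zl; lia.
split=> //.
- by move=> q; rewrite -m => /sc /andP[].
- by apply/allP => q; rewrite ll'; move/allP: le; apply.
Qed.

End Explanation.

(** * Space-time walks and their number *)

Definition vec := (int * int)%type.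
Definition vadd (v w : vec) : vec := (v.1 + w.1, v.2 + w.2).

Definition stpoint := (vec * nat)%type.

(** An excuse reaches back at most one double step, and each step moves a coordinate by at most
    1. *)
Definition adjacent (x y : stpoint) : bool :=
  [&& -2 <= x.1.1 - y.1.1 <= 2, -2 <= x.1.2 - y.1.2 <= 2
    & -2 <= x.2%:Z - y.2%:Z <= 2].

Lemma adjacent_refl : reflexive adjacent.
Proof. by move=> x; rewrite /adjacent; lia. Qed.

Lemma adjacent_sym : symmetric adjacent.
Proof. by move=> x y; rewrite /adjacent; lia. Qed.

(** Near time 0 the truncated subtraction only repeats entries. *)
Definition neighbours (x : stpoint) : seq stpoint :=
  [seq ((x.1.1 - 2 + (d.1)%:Z, x.1.2 - 2 + (d.2)%:Z), (x.2 + k - 2)%N) |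
     d <- [seq (i, j) | i <- iota 0 5, j <- iota 0 5], k <- iota 0 5].

Lemma mem_neighbours (x y : stpoint) : adjacent x y -> y \in neighbours x.
Proof.
move=> xy; apply/allpairsP.
exists ((absz (y.1.1 - x.1.1 + 2), absz (y.1.2 - x.1.2 + 2)), (y.2 + 2 - x.2)%N).
move: x y xy => [[x1 x2] x3] [[y1 y2] y3]; rewrite /adjacent => xy; rewrite /= in xy; split.
- apply/allpairsP; exists (absz (y1 - x1 + 2), absz (y2 - x2 + 2)).
  by split=> //; rewrite mem_iota /=; lia.
- by rewrite mem_iota /=; lia.
- by rewrite /=; congr ((_, _), _); lia.
Qed.

Definition extend_walks (W : stpoint -> seq (seq stpoint)) (x : stpoint) : seq (seq stpoint) :=
  [seq (if md.1 then x :: l else l) |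
     md <- [seq (m, y) | m <- [:: true; false], y <- neighbours x], l <- W md.2].

(* All lists obtained by marking some of the points of a walk from [x] with
   fewer than [n] steps. *)
Fixpoint marked_walks (n : nat) (x : stpoint) : seq (seq stpoint) :=
  if n is n'.+1 then [::] :: [:: x] :: extend_walks (marked_walks n') x else [:: [::]].

(** 252 = 2 + 2 * 125: with [x] marked or not, the walk stops or goes on to one of 125
    neighbours. *)
Lemma size_marked_walks (n : nat) (x : stpoint) :
  (size (marked_walks n x) <= 252 ^ n)%N.
Proof.
elim: n x => [|n IH] x //=; rewrite size_allpairs_dep.
have -> : (252 ^ n.+1 = 2 * 252 ^ n + 250 * 252 ^ n)%N by rewrite expnS; lia.
suff : (sumn [seq size (marked_walks n y.2) | y <-
   [seq (m, y) | m <- [:: true; false], y <- neighbours x]] <= 250 * 252 ^ n)%N.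
  by have := expn_gt0 252 n; lia.
have sz : size [seq (m, y) | m <- [:: true; false], y <- neighbours x] = 250%N.
  by rewrite size_allpairs /neighbours !size_allpairs.
have aux (s : seq (bool * stpoint)) :
    (sumn [seq size (marked_walks n y.2) | y <- s] <= size s * 252 ^ n)%N.
  by elim: s => //= a s IHs; rewrite mulSn; apply: leq_add.
by rewrite (leq_trans (aux _)) // sz.
Qed.

Lemma mem_marked_walks (n : nat) (x : stpoint) (p l : seq stpoint) :
  path adjacent x p -> subseq l (x :: p) -> (size p < n)%N -> l \in marked_walks n x.
Proof.
elim: n x p l => // n IH x [|y p] l.
  move=> _ + _; case: l => [|z l]; first by rewrite mem_head.
  by rewrite /=; case: (z =P x) => [->|//] /eqP ->; rewrite !inE eqxx.
move=> /= /andP[xy yp] sl pn; rewrite !inE; apply/orP; right; apply/orP; right.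
apply/allpairsPdep.
have [m [l' [sl' ->]]] : exists m l', subseq l' (y :: p) /\
    l = if m : bool then x :: l' else l'.
  case: l sl => [|z l] sl; first by exists false, [::]; split=> //; apply: sub0seq.
  move: sl; case: (z =P x) => [->|_] sl; first by exists true, l.
  by exists false, (z :: l).
exists (m, y), l'; split=> //; last exact: (IH y p).
by apply/allpairsP; exists (m, y); split; rewrite ?mem_neighbours //; case: (m).
Qed.

(** * Integer translations of the torus *)

Section Torus.
Variable L : nat.

Lemma ord_shift_subproof (i : 'I_L) (a : int) : (`|((i%:Z + a) %% L%:Z)%Z|%N < L)%N.
Proof. by have := ord_gt0 i; lia. Qed.

Definition ord_shift (i : 'I_L) (a : int) : 'I_L := Ordinal (ord_shift_subproof i a).

Definition translate (r : site L) (v : vec) : site L := (ord_shift r.1 v.1, ord_shift r.2 v.2).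

Lemma val_ord_shift (i : 'I_L) (a : int) : (ord_shift i a)%:Z = ((i%:Z + a) %% L%:Z)%Z.
Proof. by rewrite /=; have := ord_gt0 i; lia. Qed.

Lemma ord_shiftD (i : 'I_L) (a b : int) : ord_shift (ord_shift i a) b = ord_shift i (a + b).
Proof.
apply/val_inj; apply/eqP; rewrite -eqz_nat; apply/eqP.
by rewrite !val_ord_shift modzDml addrA.
Qed.

Lemma ord_shift0 (i : 'I_L) : ord_shift i 0 = i.
Proof.
apply/val_inj; apply/eqP; rewrite -eqz_nat; apply/eqP.
by rewrite val_ord_shift addr0 modz_small //=; have := ltn_ord i; lia.
Qed.

Lemma translateD (r : site L) (v w : vec) : translate (translate r v) w = translate r (vadd v w).
Proof. by rewrite /translate /= !ord_shiftD. Qed.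

Lemma translate0 (r : site L) : translate r (0, 0) = r.
Proof. by case: r => i j; rewrite /translate !ord_shift0. Qed.

(** The only multiple of [L] strictly between [-L] and [L] is 0. *)
Lemma ord_shift_inj (i : 'I_L) (a b : int) :
  ord_shift i a = ord_shift i b -> - L%:Z < a - b < L%:Z -> a = b.
Proof.
move=> /(congr1 (fun j : 'I_L => j%:Z)); rewrite !val_ord_shift => /eqP.
rewrite eqz_mod_dvd opprD addrACA subrr add0r => /dvdzP[q e] rng.
have q0 : q = 0 by nia.
by move: e; rewrite q0; lia.
Qed.

Lemma shI_ord_shift (i : 'I_L) (d : nat) : shI i d = ord_shift i d%:Z.
Proof. by apply/val_inj; rewrite /=; have := ord_gt0 i; lia. Qed.

Lemma shI_pred (i : 'I_L) : shI i L.-1 = ord_shift i (-1).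
Proof.
apply/val_inj/eqP; rewrite -eqz_nat val_ord_shift /= -modz_nat.
have -> : (i + L.-1)%N%:Z = i%:Z + -1 + L%:Z by have := ord_gt0 i; lia.
by rewrite modzDr.
Qed.

End Torus.

(** * The four rules in a uniform format, and their erosion functionals *)

(* The neighbourhood read by the rule at even ([false]) and odd ([true]) times. *)
Definition offsets (A : CA) (b : bool) : seq vec :=
  match A, b with
  | CA_R, false => [:: (0, 1); (0, 0); (0, -1)]
  | CA_R, true => [:: (1, 0); (0, 0); (-1, 0)]
  | CA_F, false => [:: (1, 0); (-1, -1)]
  | CA_F, true => [:: (1, 1); (0, -1)]
  | CA_M, false => [:: (1, 0); (0, 1)]
  | CA_M, true => [:: (1, 0); (0, -1)]
  | CA_T, _ => [:: (0, 0); (1, 0); (0, -1)]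
  end.

Definition is_or (A : CA) (b : bool) : bool := if A is CA_R then b else ~~ b.

Lemma rule_offsets (A : CA) (L t : nat) (s : config L) (r : site L) :
  rule A t s r = (if is_or A (odd t) then has else all) (fun v => s (translate r v))
    (offsets A (odd t)).
Proof.
case: r => i j; rewrite /rule /is_or /offsets; case: A; case: (odd t);
  rewrite /= ?andbT ?orbF /xp /xm /yp /ym /translate /= ?shI_pred ?shI_ord_shift
    ?ord_shiftD ?ord_shift0 //.
Qed.

Lemma offsets_small (A : CA) (b : bool) (v : vec) :
  v \in offsets A b -> (-1 <= v.1 <= 1) && (-1 <= v.2 <= 1).
Proof. by case: A; case: b; rewrite !inE; (do ?case/orP) => /eqP ->. Qed.

(* Parity of the times reached by a step that erodes the minority of phase [maj]:
   a step of that kind leads to the times [t] with [t + erosion_parity A maj] even. *)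
Definition erosion_parity (A : CA) (maj : bool) : bool :=
  (if A is CA_R then true else false) (+) maj.


(* In one double step the j-th functional [potj] has drift [driftj]; the third one
   is minus the sum of the first two.  For R, F and M the minority erodes along one
   direction only, and the third functional is a pure drift. *)
Definition pot1 (A : CA) (maj : bool) (v : vec) : int :=
  match A, maj with
  | CA_R, true => 2 * v.1
  | CA_R, false => 2 * v.2
  | CA_F, true => 2 * v.1 - v.2
  | CA_F, false => v.1 - 2 * v.2
  | CA_M, true => 2 * v.1 - 2 * v.2
  | CA_M, false => 2 * v.1 + 2 * v.2
  | CA_T, _ => 3 * v.1
  end.

Definition pot2 (A : CA) (maj : bool) (v : vec) : int :=
  if A is CA_T then - 3 * v.2 else - pot1 A maj v.

Definition drift1 (A : CA) : int := if A is CA_R then -1 else -2.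

Definition drift2 (A : CA) : int :=
  match A with CA_R => -1 | CA_T => -2 | _ => 1 end.

Lemma pot1D (A : CA) (maj : bool) (v w : vec) :
  pot1 A maj (vadd v w) = pot1 A maj v + pot1 A maj w.
Proof. by case: A; case: maj; rewrite /=; lia. Qed.

Lemma pot2D (A : CA) (maj : bool) (v w : vec) :
  pot2 A maj (vadd v w) = pot2 A maj v + pot2 A maj w.
Proof. by case: A; case: maj; rewrite /=; lia. Qed.

Definition gain1 A maj (a b : vec) : int := pot1 A maj (vadd a b) + drift1 A.
Definition gain2 A maj (a b : vec) : int := pot2 A maj (vadd a b) + drift2 A.

(** The erosion step makes every offset available, so [a1], [a2], [a3] may be chosen; the spreading
    step yields an uncontrolled [b], so the gains must hold for all [b]. The last bound is a gain of
    the third functional. *)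
Lemma gains (A : CA) (maj : bool) :
  let e := erosion_parity A maj in
  exists a1 a2 a3,
  [/\ a1 \in offsets A (~~ e), a2 \in offsets A (~~ e) & a3 \in offsets A (~~ e)] /\
  (forall b, b \in offsets A e ->
   [/\ 1 <= gain1 A maj a1 b, 1 <= gain2 A maj a2 b
     & gain1 A maj a3 b + gain2 A maj a3 b <= -1]).
Proof.
case: A; case: maj; rewrite /erosion_parity /=.
- by exists (1, 0), (-1, 0), (0, 0); split=> // b; rewrite !inE => /or3P[] /eqP ->.
- by exists (0, 1), (0, -1), (0, 0); split=> // b; rewrite !inE => /or3P[] /eqP ->.
- by exists (1, 0), (-1, -1), (1, 0); split=> // b; rewrite !inE => /orP[] /eqP ->.
- by exists (0, -1), (1, 1), (1, 1); split=> // b; rewrite !inE => /orP[] /eqP ->.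
- by exists (1, 0), (0, 1), (1, 0); split=> // b; rewrite !inE => /orP[] /eqP ->.
- by exists (1, 0), (0, -1), (1, 0); split=> // b; rewrite !inE => /orP[] /eqP ->.
- by exists (1, 0), (0, -1), (0, 0); split=> // b; rewrite !inE => /or3P[] /eqP ->.
- by exists (1, 0), (0, -1), (0, 0); split=> // b; rewrite !inE => /or3P[] /eqP ->.
Qed.

(** The coordinates of [vadd a b] are at most 2 in absolute value; the extreme case, [CA_T], reaches
    16. *)
Lemma gains_bounded (A : CA) (maj : bool) (a b : vec) :
  (-1 <= a.1 <= 1) && (-1 <= a.2 <= 1) -> (-1 <= b.1 <= 1) && (-1 <= b.2 <= 1) ->
  [/\ -20 <= gain1 A maj a b <= 20, -20 <= gain2 A maj a b <= 20
    & -20 <= gain1 A maj a b + gain2 A maj a b <= 20].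
Proof.
move: a b => [a1 a2] [b1 b2]; rewrite /gain1 /gain2 /= => ha hb.
by case: A; case: maj; rewrite /=; split; lia.
Qed.

(** * Explanations of minority points *)

Section Minority.
Variables (A : CA) (maj : bool) (L : nat) (omega : nat -> noise_field L) (u : site L).
Let e := erosion_parity A maj.

(** Positions are vectors of the plane covering the torus, since the linear functionals do not
    descend to the torus. *)
Definition minority (t : nat) (v : vec) : bool :=
  traj A omega (fun _ => maj) t (translate u v) != maj.

Definition noisy (x : stpoint) : bool :=
  if x.2 is t.+1 then omega t (translate u x.1) != None else false.

Lemma minority0 (v : vec) : minority 0 v = false.
Proof. by rewrite /minority eqxx. Qed.

Lemma is_or_parity : (is_or A (~~ e) = maj) * (is_or A e = ~~ maj).
Proof. by rewrite /e /is_or /erosion_parity; case: A; case: maj. Qed.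

(** At these times the connective returns the minority spin only if every spin it reads is a
    minority one; at the others one such spin suffices. *)
Lemma minority_erode (t : nat) (v : vec) :
  ~~ odd (t.+1 + e) -> minority t.+1 v -> ~~ noisy (v, t.+1) ->
  forall a, a \in offsets A (~~ e) -> minority t (vadd v a).
Proof.
move=> te; rewrite /minority /noisy /= negbK /step => + /eqP nt; rewrite nt rule_offsets.
have -> : odd t = ~~ e by move: te; rewrite oddD /=; case: (odd t); case: (e).
rewrite is_or_parity => + a aA; case: maj; rewrite ?eqb_id ?eqbF_neg ?negbK.
- by move=> /hasPn/(_ a aA); rewrite translateD.
- by move=> /allP/(_ a aA); rewrite translateD.
Qed.

Lemma minority_spread (t : nat) (v : vec) :
  odd (t.+1 + e) -> minority t.+1 v -> ~~ noisy (v, t.+1) ->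
  exists2 b, b \in offsets A e & minority t (vadd v b).
Proof.
move=> te; rewrite /minority /noisy /= negbK /step => + /eqP nt; rewrite nt rule_offsets.
have -> : odd t = e by move: te; rewrite oddD /=; case: (odd t); case: (e).
rewrite is_or_parity; case: maj; rewrite ?eqb_id ?eqbF_neg ?negbK.
- by move=> /allPn[b bA fb]; exists b => //; rewrite -translateD eqb_id.
- by move=> /hasP[b bA fb]; exists b => //; rewrite -translateD eqbF_neg negbK.
Qed.

Let off0 : vec := head (0, 0) (offsets A e).

(* A noisy point that the erosion step reads halfway through a double step is
   placed where a minority point at the start of the double step would be. *)
Definition base (x : stpoint) : vec := if odd (x.2 + e) then vadd x.1 off0 else x.1.

(** Removing the drift per double step makes [gain1] the height difference across one double
    step. *)
Definition height1 (x : stpoint) : int := pot1 A maj (base x) - drift1 A * ((x.2 + e)./2)%:Z.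
Definition height2 (x : stpoint) : int := pot2 A maj (base x) - drift2 A * ((x.2 + e)./2)%:Z.
Definition height3 (x : stpoint) : int := - height1 x - height2 x.

(** The past light cone at unit speed; confinement to it lets walks project injectively to a large
    torus. *)
Definition in_cone (x y : stpoint) : bool :=
  [&& (y.2 <= x.2)%N, - (x.2%:Z - y.2%:Z) <= y.1.1 - x.1.1 <= x.2%:Z - y.2%:Z
    & - (x.2%:Z - y.2%:Z) <= y.1.2 - x.1.2 <= x.2%:Z - y.2%:Z].

Lemma in_cone_trans (x y z : stpoint) : in_cone x y -> in_cone y z -> in_cone x z.
Proof. by rewrite /in_cone; lia. Qed.

Lemma in_cone_refl (x : stpoint) : in_cone x x.
Proof. by rewrite /in_cone; lia. Qed.

Notation explained := (explained adjacent noisy height1 height2 height3).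

Lemma off0_in : off0 \in offsets A e.
Proof. by rewrite /off0; case: A; case: (e); rewrite mem_head. Qed.

(** Induction on time by double steps: the explanations of three excuses are concatenated behind the
    new point. *)
Lemma minority_explained (v : vec) (t : nat) :
  ~~ odd (t + e) -> minority t v ->
  exists H, [/\ explained H, (v, t) \in H & {subset H <= in_cone (v, t)}].
Proof.
elim/ltn_ind: t v => t IH v te mt.
have [ny|nn] := boolP (noisy (v, t)).
  exists [:: (v, t)]; split=> //=; rewrite ?mem_head //; first by split=> //; left.
  by move=> q; rewrite inE => /eqP ->; apply: in_cone_refl.
case: t IH te mt nn => [|t] IH te mt nn; first by rewrite minority0 in mt.
have er := minority_erode te mt nn.
have exc a : a \in offsets A (~~ e) -> exists y H b,
    [/\ b \in offsets A e, explained H, y \in H & {subset H <= in_cone (v, t.+1)}] /\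
    [/\ adjacent (v, t.+1) y, height1 y = height1 (v, t.+1) + gain1 A maj a b &
        height2 y = height2 (v, t.+1) + gain2 A maj a b].
  move=> aA; have ma := er a aA; have sa := offsets_small aA.
  case: t IH te mt nn er ma => [|t] IH te mt nn er ma; first by rewrite minority0 in ma.
  have ot : odd (t.+1 + e) by move: te; rewrite oddD /= oddD /=; case: (odd t); case: (e).
  have te' : ~~ odd (t + e) by move: te; rewrite !oddD /= negbK.
  have [ny|ny] := boolP (noisy (vadd v a, t.+1)).
    (* A noisy halfway point ends the explanation; [base] gives it the height it would have with
       [off0] as the spreading offset. *)
    have sb := offsets_small off0_in.
    exists (vadd v a, t.+1), [:: (vadd v a, t.+1)], off0; split; split=> //=.
    + exact: off0_in.
    + by split=> //; left.
    + by rewrite mem_head.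
    + by move=> q; rewrite inE => /eqP ->; rewrite unfold_in /in_cone /=; clear -sa; lia.
    + by rewrite /adjacent /=; clear -sa; lia.
    + rewrite /height1 /gain1 /base /= (negbTE te') /= ?uphalf_half ?(negbTE te') !pot1D.
      by clear; lia.
    + rewrite /height2 /gain2 /base /= (negbTE te') /= ?uphalf_half ?(negbTE te') !pot2D.
      by clear; lia.
  have [b bA mb] := minority_spread ot ma ny; have sb := offsets_small bA.
  have [|H [eH yH cH]] := IH t _ (vadd (vadd v a) b) te' mb; first by [].
  exists (vadd (vadd v a) b, t), H, b; split; split=> //=.
  + move=> q /cH; apply: in_cone_trans; rewrite /in_cone /=; clear -sa sb; lia.
  + by rewrite /adjacent /=; clear -sa sb; lia.
  + rewrite /height1 /gain1 /base /= (negbTE te') /= ?uphalf_half ?(negbTE te') !pot1D; clear; lia.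
  + rewrite /height2 /gain2 /base /= (negbTE te') /= ?uphalf_half ?(negbTE te') !pot2D; clear; lia.
have [a1 [a2 [a3 [[i1 i2 i3] g]]]] := gains A maj.
have [y1 [H1 [b1 [[b1A e1 m1 c1] [n1 p1 q1]]]]] := exc a1 i1.
have [y2 [H2 [b2 [[b2A e2 m2 c2] [n2 p2 q2]]]]] := exc a2 i2.
have [y3 [H3 [b3 [[b3A e3 m3 c3] [n3 p3 q3]]]]] := exc a3 i3.
exists ((v, t.+1) :: H1 ++ H2 ++ H3); split; last 1 first.
- move=> q; rewrite inE !mem_cat => /or4P[/eqP ->|/c1|/c2|/c3] //.
  exact: in_cone_refl.
- split; first by do 2?apply: explained_cat.
  right; exists y1, y2, y3; rewrite !mem_cat m1 m2 m3 !orbT; split=> //.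
  have [g1 _ _] := g b1 b1A; have [_ g2 _] := g b2 b2A; have [_ _ g3] := g b3 b3A.
  have exc_of a b y : a \in offsets A (~~ e) -> b \in offsets A e -> adjacent (v, t.+1) y ->
      height1 y = height1 (v, t.+1) + gain1 A maj a b ->
      height2 y = height2 (v, t.+1) + gain2 A maj a b ->
      excuse adjacent height1 height2 height3 (v, t.+1) y.
    move=> /offsets_small sa /offsets_small sb n p q.
    have [bd1 bd2 bd3] := gains_bounded A maj sa sb.
    by split=> //; rewrite ?/height3 ?p ?q; clear -bd1 bd2 bd3; lia.
  split; first by split; [apply: exc_of p1 q1|apply: exc_of p2 q2|apply: exc_of p3 q3].
  by split; rewrite ?/height3 ?p1 ?q2 ?p3 ?q3; clear -g1 g2 g3; lia.
- exact: mem_head.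
Qed.

(** In the other phase one spreading step is put in front; since [l] is nonempty, 127 absorbs it. *)
Lemma minority_walk (v : vec) (t : nat) : minority t v ->
  exists p l, [/\ path adjacent (v, t) p, {subset (v, t) :: p <= in_cone (v, t)},
     subseq l ((v, t) :: p), uniq l & all noisy l] /\ (size p < 127 * size l)%N.
Proof.
have even_walk w s : ~~ odd (s + e) -> minority s w ->
    exists p l, [/\ path adjacent (w, s) p, {subset (w, s) :: p <= in_cone (w, s)},
     subseq l ((w, s) :: p), uniq l & all noisy l] /\ (size p < 126 * size l)%N.
  move=> se ms; have [H [eH yH cH]] := minority_explained se ms.
  have h0 x : height1 x + height2 x + height3 x = 0 by rewrite /height3; lia.
  have [p [l [[h1 h2 h3 h4 h5] h6]]] := explained_walk adjacent_refl adjacent_sym h0 eH yH.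
  by exists p, l; split=> //; split=> // q /h2 /cH.
move=> mt; have [te|te] := boolP (odd (t + e)); last first.
  by have [p [l [h h']]] := even_walk _ _ te mt; exists p, l; split=> //; clear -h'; lia.
have [ny|ny] := boolP (noisy (v, t)).
  exists [::], [:: (v, t)]; split=> //; split=> //=; rewrite ?eqxx ?ny //.
  by move=> q; rewrite inE => /eqP ->; apply: in_cone_refl.
case: t mt te ny => [|t] mt te ny; first by rewrite minority0 in mt.
have [b bA mb] := minority_spread te mt ny; have sb := offsets_small bA.
have te' : ~~ odd (t + e) by move: te; rewrite !oddD /=; case: (odd t); case: (e).
have [p [l [[h1 h2 h3 h4 h5] h6]]] := even_walk _ _ te' mb.
exists ((vadd v b, t) :: p), l; split; last by rewrite [size (_ :: _)]/=; clear -h6; lia.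
split=> //.
- by rewrite /= h1 andbT /adjacent /=; clear -sb; lia.
- move=> q; rewrite inE => /orP[/eqP ->|/h2]; first exact: in_cone_refl.
  by apply: in_cone_trans; rewrite /in_cone /=; clear -sb; lia.
- by apply: subseq_trans h3 (subseq_cons _ _).
Qed.

End Minority.

(** * Balls on the torus and finite speed of propagation *)

Definition box (d : nat) : seq vec :=
  [seq (i%:Z - d%:Z, j%:Z - d%:Z) | i <- iota 0 (2 * d).+1, j <- iota 0 (2 * d).+1].

Lemma mem_box (d : nat) (v : vec) :
  (v \in box d) = (- d%:Z <= v.1 <= d%:Z) && (- d%:Z <= v.2 <= d%:Z).
Proof.
apply/idP/idP => [/allpairsP[[i j] [+ + ->]]|].
  by rewrite !mem_iota /=; lia.
case: v => a b /= ab; apply/allpairsP; exists (absz (a + d%:Z), absz (b + d%:Z)).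
by split; rewrite ?mem_iota /=; [lia|lia|congr (_, _); lia].
Qed.

Definition disc (L d : nat) (r : site L) : seq (site L) := [seq translate r v | v <- box d].

Lemma size_disc (L d : nat) (r : site L) : size (disc d r) = ((2 * d).+1 ^ 2)%N.
Proof. by rewrite size_map size_allpairs size_iota. Qed.

Lemma disc_center (L d : nat) (r : site L) : r \in disc d r.
Proof.
by apply/mapP; exists (0, 0); rewrite ?translate0 // mem_box /=; lia.
Qed.

Lemma disc_sub (L d d' : nat) (r : site L) : (d <= d')%N -> {subset disc d r <= disc d' r}.
Proof.
move=> dd s /mapP[v vd ->]; apply: map_f; move: vd; rewrite !mem_box; lia.
Qed.

Lemma disc_trans (L d d' : nat) (r s : site L) (v : vec) :
  v \in box d' -> s \in disc d (translate r v) -> s \in disc (d' + d) r.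
Proof.
rewrite mem_box => vd /mapP[w]; rewrite mem_box => wd ->; rewrite translateD.
by apply: map_f; rewrite mem_box /vadd /=; lia.
Qed.

Lemma disc_meet (L d d' : nat) (r r' s : site L) :
  s \in disc d r -> s \in disc d' r' -> r' \in disc (d + d') r.
Proof.
move=> /mapP[v]; rewrite mem_box => vd -> /mapP[w]; rewrite mem_box => wd e.
apply/mapP; exists (vadd v (- w.1, - w.2)); first by rewrite mem_box /vadd /=; lia.
rewrite -translateD e translateD; case: w {wd e} => a b; rewrite /vadd /= !subrr.
by rewrite translate0.
Qed.

(** Every offset has sup norm at most 1, so the radius of dependence grows by 1 per step. *)
Lemma traj_local (A : CA) (L n : nat) (om om' : nat -> noise_field L) (s0 : config L)
    (r : site L) :
  (forall i s, (i < n)%N -> s \in disc n r -> om i s = om' i s) ->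
  traj A om s0 n r = traj A om' s0 n r.
Proof.
elim: n r => //= n IH r h; rewrite /step h ?disc_center //.
case: (om' n r) => //; rewrite !rule_offsets.
have loc v : v \in offsets A (odd n) ->
    traj A om s0 n (translate r v) = traj A om' s0 n (translate r v).
  move=> vA; apply: IH => i s ni sb; apply: h; first exact: ltnW.
  apply: (disc_trans (d' := 1) _ sb); rewrite mem_box.
  exact: offsets_small vA.
by case: ifP => _; [apply: eq_in_has|apply: eq_in_all].
Qed.

(** * The noise law and the density of minority spins *)

Section Noise.
Variables (R : realType) (p eta : R) (L t : nat).
Hypothesis p01 : 0 <= p <= 1.
Hypothesis eta11 : -1 <= eta <= 1.
Notation W := {ffun 'I_t -> noise_field L}.

Definition mu (w : W) : R := \prod_(i < t) \prod_(r : site L) noise_weight p eta (w i r).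
Definition Ex (f : W -> R) : R := \sum_w mu w * f w.

Lemma noise_weight_ge0 (a : option bool) : 0 <= noise_weight p eta a.
Proof.
move: p01 eta11 => /andP[p0 p1] /andP[e0 e1].
by case: a => [[]|] /=; rewrite ?divr_ge0 ?mulr_ge0 //; lra.
Qed.

Lemma mu_ge0 (w : W) : 0 <= mu w.
Proof.
by apply: prodr_ge0 => i _; apply: prodr_ge0 => r _; apply: noise_weight_ge0.
Qed.

Lemma sum_option_bool (F : option bool -> R) :
  \sum_a F a = F None + F (Some true) + F (Some false).
Proof.
rewrite (bigD1 None) //= (bigD1 (Some true)) //= (bigD1 (Some false)) //=.
by rewrite big1 ?addr0 ?addrA // => -[[]|].
Qed.

(** Distributivity turns the product of sums into a sum over noise fields, first over sites, then
    over times. *)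
Lemma Ex_prod (g : 'I_t -> site L -> option bool -> R) :
  Ex (fun w => \prod_(i < t) \prod_(r : site L) g i r (w i r)) =
  \prod_(i < t) \prod_(r : site L) \sum_a noise_weight p eta a * g i r a.
Proof.
under [RHS]eq_bigr do rewrite bigA_distr_bigA.
rewrite bigA_distr_bigA; apply: eq_bigr => w _.
rewrite /mu -big_split; apply: eq_bigr => i _ /=.
by rewrite -big_split.
Qed.

Lemma sum_mu : \sum_w mu w = 1.
Proof.
transitivity (Ex (fun=> \prod_(i < t) \prod_(r : site L) 1)).
  by apply: eq_bigr => w _; rewrite big1 ?mulr1 // => i _; rewrite big1.
rewrite (Ex_prod (fun _ _ _ => 1)).
rewrite big1 // => i _; rewrite big1 // => r _.
by rewrite sum_option_bool /=; lra.
Qed.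

(** The two noisy weights add up to [p] whatever the bias. *)
Lemma Ex_noisy (l : seq ('I_t * site L)) : uniq l ->
  Ex (fun w => (all (fun x => w x.1 x.2 != None) l)%:R) = p ^+ size l.
Proof.
move=> ul.
transitivity (Ex (fun w => \prod_(i < t) \prod_(r : site L)
    (if (i, r) \in l then (w i r != None)%:R else 1))).
  apply: eq_bigr => w _; congr (_ * _).
  have [al|] := boolP (all _ l).
    rewrite big1 // => i _; rewrite big1 // => r _; case: ifP => // ir.
    by move/allP: al => /(_ _ ir) /= ->.
  move=> /allPn[[i r] il /=]; rewrite negbK => /eqP wN.
  by rewrite (bigD1 i) //= (bigD1 r) //= il wN eqxx !mul0r.
rewrite (Ex_prod (fun i r a => if (i, r) \in l then (a != None)%:R else 1)) pair_bigA /=.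
transitivity (\prod_(x : 'I_t * site L) if x \in l then p else 1).
  apply: eq_bigr => -[i r] _ /=; rewrite sum_option_bool /=.
  by case: ifP => _; rewrite ?eqxx /=; lra.
by rewrite -big_mkcond prodr_const (card_uniqP ul).
Qed.

Lemma Ex_le (f g : W -> R) : (forall w, f w <= g w) -> Ex f <= Ex g.
Proof. by move=> fg; apply: ler_sum => w _; rewrite ler_wpM2l ?mu_ge0. Qed.

Lemma Ex_sum (I : Type) (s : seq I) (P : pred I) (F : I -> W -> R) :
  Ex (fun w => \sum_(i <- s | P i) F i w) = \sum_(i <- s | P i) Ex (F i).
Proof.
by rewrite /Ex; under eq_bigr do rewrite mulr_sumr; rewrite exchange_big.
Qed.

Lemma ExZ (c : R) (f : W -> R) : Ex (fun w => c * f w) = c * Ex f.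
Proof. by rewrite /Ex mulr_sumr; apply: eq_bigr => w _; ring. Qed.

Lemma ExD (f g : W -> R) : Ex (fun w => f w + g w) = Ex f + Ex g.
Proof. by rewrite /Ex -big_split; apply: eq_bigr => w _; rewrite mulrDr. Qed.

Lemma Ex_cst (c : R) : Ex (fun=> c) = c.
Proof. by rewrite /Ex -mulr_suml sum_mu mul1r. Qed.

Definition depends_on (D : pred ('I_t * site L)) (f : W -> R) : Prop :=
  forall w w' : W, (forall i r, D (i, r) -> w i r = w' i r) -> f w = f w'.

Definition mix (D : pred ('I_t * site L)) (w w' : W) : W :=
  [ffun i => [ffun r => if D (i, r) then w i r else w' i r]].

(* Independence: swapping the coordinates outside [D] of two independent copies
   of the noise preserves their joint law. *)
Lemma Ex_indep (D : pred ('I_t * site L)) (f g : W -> R) :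
  depends_on D f -> depends_on (predC D) g -> Ex (fun w => f w * g w) = Ex f * Ex g.
Proof.
move=> Df Dg.
transitivity (\sum_(q : W * W) (mu q.1 * f q.1) * (mu q.2 * g q.2)); last first.
  by rewrite /Ex big_distrlr /= pair_bigA.
pose h (q : W * W) := (mix D q.1 q.2, mix D q.2 q.1).
have hK : cancel h h.
  move=> [w w']; rewrite /h /=; congr (_, _); apply/ffunP => i; apply/ffunP => r;
  by rewrite !ffunE; case: (D (i, r)).
rewrite (reindex_inj (can_inj hK)) /=.
transitivity (\sum_(q : W * W) (mu q.1 * (f q.1 * g q.1)) * mu q.2).
  rewrite -(pair_bigA _ (fun a b => (mu a * (f a * g a)) * mu b)) /= -big_distrlr /=.
  by rewrite sum_mu mulr1.
apply: eq_bigr => -[w w'] _ /=.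
have -> : f (mix D w w') = f w by apply: Df => i r; rewrite !ffunE => ->.
have -> : g (mix D w' w) = g w by apply: Dg => i r /negbTE; rewrite !ffunE => ->.
suff e : mu (mix D w w') * mu (mix D w' w) = mu w * mu w'.
  by transitivity ((mu w * mu w') * (f w * g w)); [ring|rewrite -e; ring].
rewrite /mu -!big_split; apply: eq_bigr => i _ /=; rewrite -!big_split.
by apply: eq_bigr => r _ /=; rewrite !ffunE; case: ifP => // _; rewrite mulrC.
Qed.


Definition bad (A : CA) (maj : bool) (n : nat) (r : site L) (w : W) : bool :=
  traj A (ext_noise w) (fun _ => maj) n r != maj.

Lemma ext_noiseE (w : W) (i : 'I_t) : ext_noise w i = w i.
Proof. by rewrite /ext_noise valK. Qed.

Lemma bad_local (A : CA) (maj : bool) (n : nat) (r : site L) : (n <= t)%N ->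
  depends_on (fun x => x.2 \in disc t r) (fun w => (bad A maj n r w)%:R).
Proof.
move=> nt w w' h; rewrite /bad; congr ((_ != _)%:R); apply: traj_local => i s ni sb.
have it : (i < t)%N by apply: leq_trans ni nt.
rewrite -[i]/(val (Ordinal it)) !ext_noiseE; apply: h => /=.
exact: disc_sub sb.
Qed.

Lemma geometric_bound (x : R) (M : nat) : 0 <= x <= 1 / 2 -> \sum_(k < M) x ^+ k.+1 <= 2 * x.
Proof.
move=> /andP[x0 x1]; elim: M => [|M IH]; first by rewrite big_ord0; lra.
have -> : \sum_(k < M.+1) x ^+ k.+1 = x + x * \sum_(k < M) x ^+ k.+1.
  by rewrite big_ord_recl expr1 mulr_sumr; congr (_ + _); apply: eq_bigr => k _; rewrite -exprS.
have : x * (\sum_(i < M) x ^+ i.+1) <= x * 1 by rewrite ler_wpM2l //; lra.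
by lra.
Qed.

(** Union bound over walks: for [k] noisy points there are at most [C ^+ k] marked lists, each of
    probability at most [p ^+ k], and the geometric series is at most [2 * (C * p)]. *)
Lemma Ex_bad (C : R) (A : CA) (maj : bool) (n : nat) (r : site L) :
  (forall k, (252 ^ (127 * k))%N%:R <= C ^+ k) -> 0 <= C * p <= 1 / 32 ->
  (n <= t)%N -> (2 * t < L)%N ->
  Ex (fun w => (bad A maj n r w)%:R) <= 1 / 16.
Proof.
move=> hC /andP[C0 pC] nt tL; have p0 : 0 <= p by case/andP: p01.
case: n nt => [|n] nt.
  under eq_fun do rewrite /bad /= eqxx.
  by rewrite Ex_cst /=; lra.
pose d : 'I_t := Ordinal nt.
(* The noise field [i] acts on time [i.+1], hence the predecessor. The default [d] is never taken on
   the noisy points of the walk. *)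
pose conv (x : stpoint) : 'I_t * site L := (insubd d x.2.-1, translate r x.1).
pose walks k := marked_walks (127 * k) ((0, 0), n.+1).
pose ok k (l : seq stpoint) := uniq (map conv l) && (size l == k).
(* There are [M] noise variables, so no list of distinct ones is longer and the sum over [k] is
   finite. *)
pose M := #|{: 'I_t * site L}|.
pose F k l (w : W) : R := (ok k l && all (fun x => w x.1 x.2 != None) (map conv l))%:R.
have cover w : (bad A maj n.+1 r w)%:R <= \sum_(k < M) \sum_(l <- walks k.+1) F k.+1 l w.
  have F0 k l : 0 <= F k l w by rewrite /F ler0n.
  have [bw|_] := boolP (bad _ _ _ _ _); last first.
    by apply: sumr_ge0 => k _; apply: sumr_ge0.
  have mw : minority A maj (ext_noise w) r n.+1 (0, 0) by rewrite /minority translate0.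
  have [q [l [[h1 h2 h3 h4 h5] h6]]] := minority_walk mw.
  have lcone x : x \in l -> in_cone ((0, 0), n.+1) x.
    by move=> /(mem_subseq h3) /h2.
  have ltime x : x \in l -> exists2 i : 'I_t, x.2 = i.+1 & w i (translate r x.1) != None.
    move=> xl; have := allP h5 x xl; have := lcone x xl.
    case: x {xl} => v [|i] // /and3P[/= iN _ _] wi.
    have it : (i < t)%N by apply: leq_trans iN nt.
    exists (Ordinal it) => //.
    by move: wi; rewrite /noisy /= -{1}[i]/(val (Ordinal it)) ext_noiseE.
  have convE x (i : 'I_t) : x.2 = i.+1 -> conv x = (i, translate r x.1).
    by move=> e; rewrite /conv e /=; congr (_, _); apply: val_inj; rewrite val_insubd ltn_ord.
  (* Points of the cone at equal times differ by at most [2 * n < L] in each coordinate. *)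
  have uc : uniq (map conv l).
    rewrite map_inj_in_uniq // => x y xl yl.
    have [i xi _] := ltime x xl; have [j yj _] := ltime y yl.
    rewrite (convE _ _ xi) (convE _ _ yj) => e.
    have ij : i = j := congr1 fst e.
    have e1 := congr1 (fun z => z.2.1) e; have e2 := congr1 (fun z => z.2.2) e.
    have := lcone x xl; have := lcone y yl.
    case: x xi {xl e} e1 e2 => [[a b] k] /= -> e1 e2.
    case: y yj {yl} e1 e2 => [[a' b'] k'] /= -> e1 e2.
    rewrite /in_cone /= => c1 c2.
    have <- : a = a' by apply: ord_shift_inj e1 _; clear -c1 c2 nt tL; lia.
    have <- : b = b' by apply: ord_shift_inj e2 _; clear -c1 c2 nt tL; lia.
    by rewrite ij.
  have l0 : (0 < size l)%N by clear -h6; lia.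
  have lM : (size l <= M)%N.
    by rewrite -(size_map conv) -(card_uniqP uc) max_card.
  have kM : ((size l).-1 < M)%N by clear -l0 lM; lia.
  rewrite (bigD1 (Ordinal kM)) //=.
  have lw : l \in walks (size l) by apply: mem_marked_walks h1 h3 h6.
  rewrite prednK // (big_rem _ lw) /=.
  have -> : F (size l) l w = 1.
    rewrite /F /ok uc eqxx (_ : all _ _) //; apply/allP => _ /mapP[x xl ->].
    by have [i xi wi] := ltime x xl; rewrite (convE _ _ xi).
  by rewrite -addrA lerDl addr_ge0 // ?sumr_ge0 // => k _; rewrite sumr_ge0.
apply: le_trans (Ex_le cover) _; rewrite Ex_sum.
apply: (@le_trans _ _ (\sum_(k < M) (C * p) ^+ k.+1)); last first.
  by apply: le_trans (geometric_bound _ _) _; [apply/andP; split; lra|lra].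
apply: ler_sum => k _; rewrite Ex_sum.
apply: (@le_trans _ _ (\sum_(l <- walks k.+1) p ^+ k.+1)).
  apply: ler_sum => l _; rewrite /F.
  case: (boolP (ok k.+1 l)) => [/andP[ul /eqP <-]|_] /=.
    by rewrite Ex_noisy // size_map.
  by rewrite Ex_cst exprn_ge0.
rewrite big_const_seq count_predT iter_addr_0 -mulr_natl exprMn.
rewrite ler_wpM2r ?exprn_ge0 //; apply: le_trans (hC _).
by rewrite ler_nat size_marked_walks.
Qed.

End Noise.

(** * Concentration of the magnetization and survival *)

Section Survival.
Variables (R : realType) (p eta : R) (L t : nat).
Hypothesis p01 : 0 <= p <= 1.
Hypothesis eta11 : -1 <= eta <= 1.
Notation W := {ffun 'I_t -> noise_field L}.
Notation Ex := (Ex p eta).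

(** Disjoint balls of radius [t] give independent spins; otherwise the joint probability is bounded
    by 1. *)
Lemma Ex_bad_pair (A : CA) (maj : bool) (n : nat) (r r' : site L) : (n <= t)%N ->
  Ex (fun w : W => (bad A maj n r w)%:R * (bad A maj n r' w)%:R) <=
  Ex (fun w : W => (bad A maj n r w)%:R) * Ex (fun w : W => (bad A maj n r' w)%:R)
    + (r' \in disc (t + t) r)%:R.
Proof.
move=> nt; have ge0 s : 0 <= Ex (fun w : W => (bad A maj n s w)%:R).
  by apply: sumr_ge0 => w _; rewrite mulr_ge0 ?mu_ge0 ?ler0n.
have [rr|rr] := boolP (r' \in _).
  apply: (@le_trans _ _ (Ex (fun=> 1))).
    apply: Ex_le => // w; do 2!case: (bad _ _ _ _ _); rewrite ?mulr1 ?mulr0 ?mul0r //.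
  by rewrite Ex_cst // lerDr mulr_ge0.
rewrite addr0 (@Ex_indep _ p eta L t (fun x => x.2 \in disc t r)) //; first exact: bad_local.
move=> w w' h; apply: (@bad_local R L t A maj n r' nt).
move=> i s si; apply: h => /=; apply: contra rr => sr; exact: disc_meet sr si.
Qed.

(** Chebyshev: each site is correlated with at most [(4 * t).+1 ^ 2] sites, the size of a ball of
    radius [2 * t]. *)
Lemma Ex_many_bad (C : R) (A : CA) (maj : bool) (n : nat) :
  (forall k, (252 ^ (127 * k))%N%:R <= C ^+ k) -> 0 <= C * p <= 1 / 32 ->
  (n <= t)%N -> (2 * t < L)%N ->
  Ex (fun w : W => (L%:R ^+ 2 / 4 < \sum_r (bad A maj n r w)%:R :> R)%:R) <=
    64 * (((4 * t).+1 ^ 2)%N%:R / L%:R ^+ 2).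
Proof.
move=> hC pC nt tL.
have L0 : 0 < L%:R :> R by rewrite ltr0n; lia.
set N : R := L%:R ^+ 2; have N0 : 0 < N by rewrite exprn_gt0.
set B : R := ((4 * t).+1 ^ 2)%N%:R.
pose b r (w : W) : R := (bad A maj n r w)%:R.
pose m r := Ex (b r); pose S := \sum_r m r.
have cardN : \sum_(r : site L) (1 : R) = N.
  by rewrite sumr_const card_prod card_ord mulnn natrX.
have S_le : S <= N / 16.
  apply: (@le_trans _ _ (\sum_(r : site L) 1 / 16)).
    by apply: ler_sum => r _; exact: (Ex_bad p01 eta11 _ _ _ hC pC nt tL).
  by rewrite -mulr_suml cardN.
have square : Ex (fun w => (\sum_r b r w) * (\sum_r b r w)) <= S * S + N * B.
  under eq_fun do rewrite big_distrlr /=.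
  rewrite Ex_sum -cardN [S * S]big_distrlr mulr_suml -big_split /=.
  apply: ler_sum => r _; rewrite Ex_sum mul1r.
  apply: le_trans (ler_sum _ (fun r' _ => Ex_bad_pair A maj r r' nt)) _.
  rewrite big_split lerD2l /= -natr_sum ler_nat.
  have -> : (\sum_r' (r' \in disc (t + t) r) = #|disc (t + t) r|)%N.
    by rewrite -sum1_card [RHS]big_mkcond; apply: eq_bigr => r' _; case: (_ \in _).
  apply: leq_trans (card_size _) _; rewrite size_disc.
  by rewrite (_ : 2 * (t + t) = 4 * t)%N //; lia.
(* Exceeding [N / 4] with mean at most [N / 16] is a deviation of at least [N / 8], and
   [c * (N / 8) ^+ 2 = 1]. *)
pose c := 64 / N ^+ 2.
apply: (@le_trans _ _ (Ex (fun w => c * ((\sum_r b r w) * (\sum_r b r w) +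
     ((- 2 * S) * (\sum_r b r w) + S * S))))).
  apply: Ex_le => // w; rewrite -/(b _ w); set X := \sum_r b r w.
  have -> : X * X + (- 2 * S * X + S * S) = (X - S) ^+ 2 by ring.
  have c0 : 0 <= c by rewrite divr_ge0 ?exprn_ge0 // ltW.
  case: ltP => [XN|_] /=; last by rewrite mulr_ge0 ?sqr_ge0.
  have h : N / 8 <= X - S by lra.
  have : c * (N / 8) ^+ 2 <= c * (X - S) ^+ 2.
    by rewrite ler_wpM2l // lerXn2r ?nnegrE; lra.
  have -> : c * (N / 8) ^+ 2 = 1 by rewrite /c; field; rewrite gt_eqF.
  by [].
have EX : Ex (fun w => \sum_r b r w) = S by rewrite Ex_sum.
have E2 : Ex (fun w => (- 2 * S) * (\sum_r b r w) + S * S) = - 2 * S * S + S * S.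
  rewrite ExD; congr (_ + _); last exact: Ex_cst.
  by rewrite (ExZ p eta (- 2 * S) (fun w => \sum_r b r w)) EX.
rewrite ExZ ExD E2.
have -> : 64 * (B / N) = c * (N * B) by rewrite /c; field; rewrite gt_eqF.
apply: ler_wpM2l; first by rewrite divr_ge0 ?exprn_ge0 // ltW.
rewrite -lerBrDr; apply: (le_trans square); rewrite le_eqVlt; apply/orP; left.
by apply/eqP; ring.
Qed.

Lemma magn_minority (maj : bool) (s : config L) : (0 < L)%N ->
  (1 / 2 <= (if maj then magn R s else - magn R s)) =
  (\sum_r (s r != maj)%:R <= L%:R ^+ 2 / 4 :> R).
Proof.
move=> L0; set N : R := L%:R ^+ 2; set X := \sum_r _.
have N0 : 0 < N by rewrite exprn_gt0 ?ltr0n.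
have cardN : \sum_(r : site L) (1 : R) = N.
  by rewrite sumr_const card_prod card_ord mulnn natrX.
have -> : (if maj then magn R s else - magn R s) = (N - 2 * X) / N.
  have -> : N - 2 * X = (if maj then 1 else -1) * \sum_r (if s r then 1 else -1).
    rewrite /X -cardN !mulr_sumr -sumrB; apply: eq_bigr => r _.
    by case: (s r); case: (maj) => /=; lra.
  by rewrite /magn -/N; case: (maj); rewrite ?mul1r ?mulN1r ?mulNr.
by rewrite ler_pdivlMr //; apply/idP/idP; lra.
Qed.

(** Union bound over [t.+1] times and both initial states, whence 128 = 2 * 64. *)
Lemma surv_prob_ge (C : R) (A : CA) :
  (forall k, (252 ^ (127 * k))%N%:R <= C ^+ k) -> 0 <= C * p <= 1 / 32 ->
  (2 * t < L)%N ->
  1 - 128 * ((t.+1 * (4 * t).+1 ^ 2)%N%:R / L%:R ^+ 2) <= surv_prob A L p eta t.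
Proof.
move=> hC pC tL; set B : R := ((4 * t).+1 ^ 2)%N%:R / L%:R ^+ 2.
pose F maj n (w : W) : R := (L%:R ^+ 2 / 4 < \sum_r (bad A maj n r w)%:R :> R)%:R.
have -> : surv_prob A L p eta t = Ex (fun w : W => (survives R A w)%:R).
  by apply: eq_bigr => w _; rewrite -/(mu p eta w); case: ifP; rewrite ?mulr1 ?mulr0.
have cover (w : W) : 1 <= (survives R A w)%:R + \sum_(n < t.+1) (F true n w + F false n w).
  have F0 maj n : 0 <= F maj n w by rewrite /F ler0n.
  have [_|/forallPn[n]] := boolP (survives R A w).
    by rewrite lerDl sumr_ge0 // => n _; rewrite addr_ge0.
  have L0 : (0 < L)%N by lia.
  have := magn_minority true (traj A (ext_noise w) (@splus L) n) L0.
  have := magn_minority false (traj A (ext_noise w) (@sminus L) n) L0.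
  move=> /= -> ->; rewrite add0r negb_and -!ltNge => h.
  rewrite (bigD1 n) //=; apply: (@le_trans _ _ (F true n w + F false n w)); last first.
    by rewrite lerDl sumr_ge0 // => k _; rewrite addr_ge0.
  by case/orP: h => h; rewrite {1 2}/F {1}/bad h ?lerDl ?lerDr.
have := Ex_le p01 eta11 cover.
rewrite Ex_cst // ExD Ex_sum.
set E := \sum_(n < _) _ => h.
have : E <= \sum_(n < t.+1) (64 * B + 64 * B).
  apply: ler_sum => n _; have nt : (n <= t)%N by rewrite -ltnS.
  by rewrite ExD lerD // (Ex_many_bad _ _ hC pC nt tL).
rewrite sumr_const card_ord -mulr_natl => h2.
have e : (t.+1 * (4 * t).+1 ^ 2)%N%:R / L%:R ^+ 2 = t.+1%:R * B :> R.
  by rewrite natrM mulrA.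
by rewrite e; lra.
Qed.

End Survival.

(** * Divergence of the memory time *)

Lemma surv_prob_ge0 (R : realType) (p eta : R) (A : CA) (L t : nat) :
  0 <= p <= 1 -> -1 <= eta <= 1 -> 0 <= surv_prob A L p eta t.
Proof.
move=> p01 eta11; apply: sumr_ge0 => w _; case: ifP => // _.
exact: mu_ge0.
Qed.

(** For large [L] each of the first [k] terms of the tail sum is at least 1/2, and [k] is
    arbitrary. *)
Lemma t_mem_cvg (R : realType) (C p eta : R) (A : CA) :
  (forall k, (252 ^ (127 * k))%N%:R <= C ^+ k) -> 0 <= C * p <= 1 / 32 ->
  0 <= p <= 1 -> -1 <= eta <= 1 -> (t_mem A L p eta @[L --> \oo] --> +oo)%E.
Proof.
move=> hC pC p01 eta11; apply/cvgeyPge => M.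
have [k Mk] : exists k : nat, M <= k%:R * (1 / 2).
  exists (Num.bound `|2 * M|).
  by have := archi_boundP (normr_ge0 (2 * M)); have := ler_norm (2 * M); lra.
pose K := (k.+1 * (4 * k).+1 ^ 2)%N.
(* This makes the loss [128 * (B / L ^+ 2)] at most 1/2 for all times below [k], and ensures
   [2 * t < L]. *)
exists (256 * K)%N => // L /= KL.
have half t : (t < k)%N -> 1 / 2 <= surv_prob A L p eta t.
  move=> tk; have kK : (4 * k < K)%N by rewrite /K; clear; nia.
  have tL : (2 * t < L)%N by clear -tk kK KL; lia.
  apply: le_trans (surv_prob_ge p01 eta11 A hC pC tL).
  set B : nat := (t.+1 * _)%N.
  have BK : (B <= K)%N by rewrite /B /K leq_mul ?leq_exp2r //; clear -tk; lia.
  have L0 : 0 < L%:R :> R by rewrite ltr0n; clear -tL; lia.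
  have : B%:R / L%:R ^+ 2 <= 1 / 256 :> R.
    rewrite ler_pdivrMr ?exprn_gt0 //.
    have h1 : (256 * B <= L * L)%N by clear -BK KL tL; nia.
    have : (256 * B)%N%:R <= (L * L)%N%:R :> R by rewrite ler_nat.
    by rewrite !natrM expr2; lra.
  by lra.
apply: le_trans (nneseries_lim_ge (m := 0%N) k _); last first.
  by move=> t _ _; rewrite lee_fin surv_prob_ge0.
rewrite big_mkord sumEFin lee_fin; apply: le_trans Mk _.
apply: (@le_trans _ _ (\sum_(t < k) 1 / 2)).
  by rewrite sumr_const card_ord mulr_natl.
by apply: ler_sum => t _; apply: half.
Qed.

Theorem theorem1 (R : realType) (A : CA) : robust_memory R A.
Proof.
(* [C] is kept abstract so that 252 to the power 127 is never evaluated. *)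
have [C [C1 hC]] : exists C : R, 1 <= C /\
    forall k, (252 ^ (127 * k))%N%:R <= C ^+ k.
  exists (252 ^+ 127); split; first by rewrite exprn_ege1 // ler1n.
  by move=> k; rewrite natrX exprM.
pose q := (32 * C)^-1.
have q0 : 0 < q by rewrite invr_gt0; lra.
have Cq : C * q = 1 / 32 by rewrite /q; field; rewrite gt_eqF //; lra.
have q1 : q <= 1 / 32 by nra.
(* The disc is tangent to the line [p = 0] and stays in [0 < p < q], where [C * p] is below 1/32. *)
exists (q / 2), 0, (q / 2); split=> [|p eta h]; first by lra.
have e2 : eta ^+ 2 < (q / 2) ^+ 2 by have := sqr_ge0 (p - q / 2); move: h; rewrite subr0; lra.
have p2 : (p - q / 2) ^+ 2 < (q / 2) ^+ 2 by have := sqr_ge0 (eta - 0); lra.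
have pp : 0 < p by rewrite ltNge; apply/negP => np; nra.
have pq : p < q by rewrite ltNge; apply/negP => np; nra.
have p01 : 0 <= p <= 1 by apply/andP; split; lra.
have eta11 : -1 <= eta <= 1 by apply/andP; split; rewrite leNgt; apply/negP => ne; nra.
split=> //; apply: t_mem_cvg hC _ p01 eta11.
by apply/andP; split; [rewrite mulr_ge0|rewrite -Cq ler_wpM2l]; lra.
Qed.
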